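(* Let $\pi\in\mathcal S_N$ be an involution, with an associated chord diagram also called $\pi$. Construct a new chord diagram $\rho$ in one of three ways: 1. if two arches in $\pi$ border a common region, but do not cross, make them touch and turn that into a new crossing; 2. if an arch and a half-line in $\pi$ border a common region, but do not cross, make them touch and turn that into a new crossing; 3. if an arch crosses all the half-lines, and borders an unbounded region, break it into two half-lines. Then $\pi>\rho$ in the poset of orbit closures, i.e. $\overline{B_N\cdot\pi_<}\supset B_N\cdot\rho_<$.
   Context: Base field $\mathbb C$; $N$ is any positive integer. $R_N$ is the space of upper triangular $N\times N$ matrices, $B_N$ the group of invertible upper triangular matrices, acting by conjugation, and $D=\{M\in\mathrm{Mat}_N:M^2=0\}$. For an involution $\pi\in\mathcal S_N$ (fixed points allowed), $\pi_<$ is the strictly upper triangular part of its permutation matrix (entry $1$ at $(i,\pi(i))$ when $i<\pi(i)$, and $0$ elsewhere). It is known that $\pi\mapsto B_N\cdot\pi_<$ is a bijection from involutions in $\mathcal S_N$ to $B_N$-orbits on $D\cap R_N$; the orbits (hence the involutions) are partially ordered by inclusion of orbit closures. Chord diagrams: $\pi$ is drawn in the upper half-plane with points $1,\ldots,N$ on the boundary line, with an arch connecting $i\leftrightarrow\pi(i)$ for each 2-cycle and a vertical half-line (going to infinity) from each fixed point $i$, such that any two curves (arches or half-lines) cross transversely and at most once. A given involution may have several such drawings; any of them may be used. Thus arches $i<\pi(i)$ and $j<\pi(j)$ cross iff $i<j<\pi(i)<\pi(j)$ up to exchanging them; an arch $j<k$ crosses the half-line at $i$ iff $j<i<k$; half-lines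 do not cross each other. Regions are the connected components of the complement of the curves in the upper half-plane. In terms of involutions: in move 1, if the four endpoints of the two noncrossing arches are $p<q<r<s$, then $\rho$ has arches $p\leftrightarrow r$ and $q\leftrightarrow s$ instead; in move 2, a half-line at $i$ and an arch $j\leftrightarrow k$ with $i<j<k$ are replaced by the arch $i\leftrightarrow k$ and a half-line at $j$, while if $j<k<i$ they are replaced by the arch $j\leftrightarrow i$ and a half-line at $k$; in move 3, the arch $j\leftrightarrow k$ is replaced by half-lines at $j$ and $k$. All other curves are unchanged. *)

(* Defs.v *)
From HB Require Import structures.
From mathcomp Require Export all_boot all_order all_algebra all_fingroup.
From mathcomp Require Export all_classical all_reals all_analysis.
From mathcomp.real_closed Require Export complex.
(* multinomials' notations clash with those of mathcomp-analysis *)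
From mathcomp Require Import -(notations) mpoly.

Set Implicit Arguments.
Unset Strict Implicit.
Unset Printing Implicit Defensive.

Import Order.TTheory GRing.Theory Num.Theory numFieldNormedType.Exports.

Local Open Scope classical_set_scope.
Local Open Scope ring_scope.

Definition is_involution N (p : 'S_N) : Prop := forall i, p (p i) = i.

Definition upper_triangular (K : fieldType) N (M : 'M[K]_N) : Prop :=
  forall i j : 'I_N, (j < i)%N -> M i j = 0.

Definition borel (K : fieldType) N : set 'M[K]_N :=
  [set g | g \in unitmx /\ upper_triangular g].
Arguments borel K N : clear implicits.

Definition B_orbit (K : fieldType) N (M : 'M[K]_N) : set 'M[K]_N :=
  [set g *m M *m invmx g | g in borel K N].

Definition pi_lt (K : fieldType) N (p : 'S_N) : 'M[K]_N :=
  \matrix_(i, j) ((i < j)%N && (p i == j))%:R.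
Arguments pi_lt K {N} p.

(* Zariski closure in the affine space Mat_N; a polynomial in the N * N
   matrix entries is evaluated at M through mxvec M. *)
Definition zariski_closure (K : fieldType) N (S : set 'M[K]_N) :
    set 'M[K]_N :=
  [set M | forall f : mpoly (N * N) K,
     (forall A, S A -> meval (fun k => mxvec A 0 k) f = 0) ->
     meval (fun k => mxvec M 0 k) f = 0].

Definition orbit_closure (K : fieldType) N (p : 'S_N) : set 'M[K]_N :=
  zariski_closure (B_orbit (pi_lt K p)).
Arguments orbit_closure K {N} p.

(* The strict order p > r: proper inclusion of orbit closures. *)
Definition orbit_gt (K : fieldType) N (p r : 'S_N) : Prop :=
  orbit_closure K r `<` orbit_closure K p.
Arguments orbit_gt K {N} p r.

(* Every curve of a diagram is indexed by its leftmost boundary point: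
   an arch i <-> p i with i < p i by i, a half-line by its fixed point. *)
Definition arch_at N (p : 'S_N) (i : 'I_N) : bool := (i < p i)%N.
Definition halfline_at N (p : 'S_N) (i : 'I_N) : bool := p i == i.
Definition curve_at N (p : 'S_N) (i : 'I_N) : bool := (i <= p i)%N.

Definition arches_cross N (p : 'S_N) (i j : 'I_N) : bool :=
  [&& (i < j)%N, (j < p i)%N & (p i < p j)%N]
  || [&& (j < i)%N, (i < p j)%N & (p j < p i)%N].

Definition arch_crosses_halfline N (p : 'S_N) (j i : 'I_N) : bool :=
  (j < i)%N && (i < p j)%N.

(* 'I_N counts from 0, the boundary points are (1,0), ..., (N,0). *)
Definition boundary_point (R : realType) N (i : 'I_N) : R * R :=
  ((i.+1)%:R, 0).
Arguments boundary_point R {N} i.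

Definition upper_half_plane (R : realType) : set (R * R) :=
  [set z | 0 < z.2].

Definition param_domain (R : realType) N (p : 'S_N) (i : 'I_N) : set R :=
  if halfline_at p i then [set t | 0 <= t] else [set t | 0 <= t <= 1].
Arguments param_domain R {N} p i.

Definition curve_of (R : realType) N (p : 'S_N) (a : 'I_N -> R -> R * R)
    (i : 'I_N) (t : R) : R * R :=
  if halfline_at p i then ((i.+1)%:R, t) else a i t.

Definition trace_of (R : realType) N (p : 'S_N) (a : 'I_N -> R -> R * R)
    (i : 'I_N) : set (R * R) :=
  curve_of p a i @` param_domain R p i.

Definition transverse_at (R : realType) (f g : R -> R * R) (s t : R) : Prop :=
  [/\ derivable f s 1, derivable g t 1 &
      ('D_1 f s).1 * ('D_1 g t).2 - ('D_1 f s).2 * ('D_1 g t).1 != 0].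

(* A drawing of p. The half-lines are the vertical ones, so only the arches
   are data; the values of [arch] at indices with p i <= i are irrelevant. *)
Record drawing (R : realType) N (p : 'S_N) := Drawing {
  arch : 'I_N -> R -> R * R ;
  arch_continuous : forall i, arch_at p i ->
    {within [set t | 0 <= t <= 1], continuous (arch i)} ;
  arch_injective : forall i, arch_at p i -> forall s t,
    0 <= s <= 1 -> 0 <= t <= 1 -> arch i s = arch i t -> s = t ;
  arch_start : forall i, arch_at p i -> arch i 0 = boundary_point R i ;
  arch_end : forall i, arch_at p i -> arch i 1 = boundary_point R (p i) ;
  arch_upper : forall i, arch_at p i -> forall t,
    0 < t < 1 -> upper_half_plane (arch i t) ;
  curves_meet_once : forall i j, curve_at p i -> curve_at p j -> i != j ->
    forall z w, trace_of p arch i z -> trace_of p arch j z ->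
      trace_of p arch i w -> trace_of p arch j w -> z = w ;
  curves_transverse : forall i j, curve_at p i -> curve_at p j -> i != j ->
    forall s t, param_domain R p i s -> param_domain R p j t ->
      curve_of p arch i s = curve_of p arch j t ->
      transverse_at (curve_of p arch i) (curve_of p arch j) s t }.

Definition curve_complement (R : realType) N (p : 'S_N) (d : drawing R p) :
    set (R * R) :=
  [set z | upper_half_plane z /\
           forall i, curve_at p i -> ~ trace_of p (arch d) i z].

Definition is_region (R : realType) N (p : 'S_N) (d : drawing R p)
    (U : set (R * R)) : Prop :=
  exists2 z, curve_complement d z &
    U = connected_component (curve_complement d) z.

(* A nondegenerate piece of the curve lies on the boundary of U; touching U at
   a single (multiple) crossing point is not enough. *)
Definition borders (R : realType) N (p : 'S_N) (d : drawing R p) (i : 'I_N)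
    (U : set (R * R)) : Prop :=
  exists a b : R, [/\ a < b,
    forall t, a < t < b -> param_domain R p i t &
    forall t, a < t < b -> closure U (curve_of p (arch d) i t)].

Definition border_common_region (R : realType) N (p : 'S_N)
    (d : drawing R p) (i j : 'I_N) : Prop :=
  exists U, [/\ is_region d U, borders d i U & borders d j U].

Definition borders_unbounded_region (R : realType) N (p : 'S_N)
    (d : drawing R p) (i : 'I_N) : Prop :=
  exists U, [/\ is_region d U, ~ bounded_set U & borders d i U].

Definition agree_off N (p r : 'S_N) (s : seq 'I_N) : Prop :=
  forall x, x \notin s -> r x = p x.

Definition move1 (R : realType) N (p : 'S_N) (d : drawing R p) (r : 'S_N) :
    Prop :=
  exists i j : 'I_N,
    [/\ arch_at p i /\ arch_at p j, i != j, ~~ arches_cross p i j,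
        border_common_region d i j &
        exists a b c e : 'I_N,
          [/\ [&& (a < b)%N, (b < c)%N & (c < e)%N],
              perm_eq [:: a; b; c; e] [:: i; p i; j; p j],
              r a = c /\ r c = a, r b = e /\ r e = b &
              agree_off p r [:: a; b; c; e]]].

Definition move2 (R : realType) N (p : 'S_N) (d : drawing R p) (r : 'S_N) :
    Prop :=
  exists i j : 'I_N, let k := p j in
    [/\ halfline_at p i /\ arch_at p j, ~~ arch_crosses_halfline p j i,
        border_common_region d i j,
        agree_off p r [:: i; j; k] &
        ((i < j)%N /\ [/\ r i = k, r k = i & r j = j]) \/
        ((k < i)%N /\ [/\ r j = i, r i = j & r k = k])].

Definition move3 (R : realType) N (p : 'S_N) (d : drawing R p) (r : 'S_N) :
    Prop :=
  exists j : 'I_N, let k := p j in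
    [/\ arch_at p j,
        forall i, halfline_at p i -> arch_crosses_halfline p j i,
        borders_unbounded_region d j,
        r j = j /\ r k = k &
        agree_off p r [:: j; k]].

(* Main.v *)
Require Import Defs.
From mathcomp Require Import ring zify.
From mathcomp Require Import -(notations) mpoly.

(** Inclusion of orbit closures follows by writing down, for each move, a line
    [r_< + t C] of matrices that lie in the orbit of [p_<] for every [t <> 0]:
    a polynomial vanishing on that orbit vanishes on the whole line, hence at
    [r_<] ([zariski_closure_line]).  As the closure of an orbit is stable under
    the group, it then contains the orbit and the orbit closure of [r_<].

    In matrix units the lines are
    - [e_jk] to [t e_jk] when the arch [j <-> k] is broken;
    - [e_jk] to [e_ik + t e_jk] or [e_ji + t e_jk] when an arch and a
      half-line are made to cross;
    - [e_ae + e_bc] to [e_ac + e_be + t e_bc] for two nested arches;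
    - [e_ab + e_ce] to [e_ac + e_be + t (e_ce - e_ab)] for two arches side by
      side.
    Each is obtained by conjugating with an explicit [1 + E], where [E] is
    supported on the boundary points taking part in the move; since the
    involution preserves this set of points, the other curves do not feel
    [1 + E] ([local_degeneration]).

    Strictness comes from an invariant.  For an upper triangular [g], the block
    of [g M g^-1] with rows at least [a] and columns at most [b] is determined
    by [g] and the same block of [M], and its rank for [M = p_<] is the number of
    arches inside [[a, b]]; bounds on this rank are vanishing conditions on
    minors, so they pass to the closure ([pi_lt_notin_orbit_closure]).  Each
    move destroys some arch [x <-> p x] without creating an arch inside its
    span ([orbit_gt_witness]). *)

Set Implicit Arguments.
Unset Strict Implicit.
Unset Printing Implicit Defensive.

Import Order.TTheory GRing.Theory Num.Theory.
Local Open Scope classical_set_scope.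
Local Open Scope ring_scope.

(** * Upper triangular matrices *)

Lemma unitmx_upper_triangular (K : fieldType) N (g : 'M[K]_N) :
  upper_triangular g -> (g \in unitmx) = [forall i, g i i != 0].
Proof.
move=> ug; have trig : is_trig_mx g^T.
  by apply/is_trig_mxP => i j lt_ij; rewrite mxE ug.
rewrite unitmxE unitfE -det_tr det_trig // prodf_seq_neq0.
rewrite -big_all big_andE; apply/forallP/forallP => nz i.
  by have := nz i; rewrite mxE.
by rewrite mxE nz.
Qed.

Lemma upper_triangular_mul (K : fieldType) N (g h : 'M[K]_N) :
  upper_triangular g -> upper_triangular h -> upper_triangular (g *m h).
Proof.
move=> ug uh i j lt_ji; rewrite mxE big1 // => k _.
have [lt_ki|le_ik] := ltnP k i; first by rewrite ug ?mul0r.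
by rewrite uh ?mulr0 // (leq_trans lt_ji).
Qed.

(** The entries of row [i] of the inverse [G] left of the diagonal vanish one
    after the other: entry [(i, j)] of [G g = 1] reads [G i j * g j j = 0]
    once the entries of [G] further left are known to be zero. *)
Lemma upper_triangular_inv (K : fieldType) N (g : 'M[K]_N) :
  borel K N g -> upper_triangular (invmx g).
Proof.
move=> [unit_g ug] i j; have [n] := ubnP j.
elim: n j => // n IHn j /ltnSE le_jn lt_ji.
have := congr1 (fun A : 'M[K]_N => A i j) (mulVmx unit_g).
rewrite !mxE -val_eqE gtn_eqF ?lt_ji //.
rewrite (bigD1 j) //= big1 ?addr0.
  move/eqP; rewrite mulf_eq0 => /orP[/eqP //|g0].
  move: unit_g; rewrite unitmx_upper_triangular // => /forallP/(_ j).
  by rewrite g0.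
move=> k ne_kj; have [lt_jk|lt_kj|/val_inj eq_kj] := ltngtP j k.
- by rewrite ug ?mulr0.
- by rewrite IHn ?mul0r //; lia.
- by rewrite eq_kj eqxx in ne_kj.
Qed.

Lemma borel_mul (K : fieldType) N (g h : 'M[K]_N) :
  borel K N g -> borel K N h -> borel K N (g *m h).
Proof.
move=> [unit_g ug] [unit_h uh]; split; first by rewrite unitmx_mul unit_g.
exact: upper_triangular_mul.
Qed.

Lemma invmx_mul (K : fieldType) N (g h : 'M[K]_N) :
  g \in unitmx -> h \in unitmx -> invmx (g *m h) = invmx h *m invmx g.
Proof.
move=> unit_g unit_h; apply: (can_inj (mulKmx (_ : g *m h \in unitmx))).
  by rewrite unitmx_mul unit_g.
by rewrite mulmxV ?unitmx_mul ?unit_g // -mulmxA mulKVmx ?mulmxV.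
Qed.

Lemma mem_B_orbit (K : fieldType) N (M A g : 'M[K]_N) :
  borel K N g -> g *m M = A *m g -> B_orbit M A.
Proof.
by move=> bg gM; exists g => //; rewrite gM mulmxK //; case: bg.
Qed.

Lemma B_orbit_conj (K : fieldType) N (M A g : 'M[K]_N) :
  borel K N g -> B_orbit M A -> B_orbit M (g *m A *m invmx g).
Proof.
move=> bg [h bh <-]; exists (g *m h); first exact: borel_mul.
by rewrite invmx_mul; [rewrite !mulmxA | case: bg | case: bh].
Qed.

(** * Zariski closure *)

Lemma zariski_closure_min (K : fieldType) N (S T : set 'M[K]_N) :
  S `<=` zariski_closure T -> zariski_closure S `<=` zariski_closure T.
Proof. by move=> ST M clM f fT; apply: clM => A /ST; apply. Qed.

(** Linear maps are polynomial: vanishing polynomials pull back along [L]. *)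
Lemma zariski_closure_linear (K : fieldType) N
    (L : {linear 'M[K]_N -> 'M[K]_N}) (S : set 'M[K]_N) :
  (forall A, S A -> S (L A)) ->
  forall M, zariski_closure S M -> zariski_closure S (L M).
Proof.
move=> SL M clM f fS.
pose coords := [tuple \sum_l lin_mx L l k *: mpolyX K (mnm1 l) | k < N * N].
have compE A : meval (fun k => mxvec A 0 k) (comp_mpoly coords f) =
    meval (fun k => mxvec (L A) 0 k) f.
  rewrite comp_mpoly_meval; apply: meval_eq => k.
  rewrite tnth_mktuple -mul_vec_lin mxE raddf_sum; apply: eq_bigr => l _ /=.
  by rewrite mevalZ mevalXU mulrC.
by rewrite -compE; apply: clM => A SA; rewrite compE; apply/fS/SL.
Qed.

(** A polynomial restricted to the line [A + e C] is a polynomial in [e]; if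
    it vanishes for all nonzero [e], it has too many roots not to vanish at
    [e = 0] as well. *)
Lemma zariski_closure_line (K : numFieldType) N (S : set 'M[K]_N)
    (A C : 'M[K]_N) :
  (forall e, e != 0 -> S (A + e *: C)) -> zariski_closure S A.
Proof.
move=> SAC f fS.
pose line k : {poly K} := (mxvec A 0 k)%:P + mxvec C 0 k *: 'X.
pose q : {poly K} := mmap polyC line f.
have qE e : q.[e] = meval (fun k => mxvec (A + e *: C) 0 k) f.
  rewrite mevalE /q /mmap horner_sum; apply: eq_bigr => m _.
  rewrite hornerM hornerC /mmap1 horner_prod; congr (_ * _).
  apply: eq_bigr => k _; rewrite horner_exp !linearD linearZ /= !mxE.
  by rewrite /line hornerD hornerC hornerZ hornerX [e * _]mulrC.
have q0 : q = 0.
  apply/eqP/negPn/negP => nz_q.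
  pose rs : seq K := [seq n.+1%:R | n <- iota 0 (size q)].
  suff : (size rs < size q)%N by rewrite size_map size_iota ltnn.
  apply: max_poly_roots => //.
    apply/allP => _ /mapP[n _ ->]; apply/eqP.
    by rewrite qE; apply/fS/SAC; rewrite pnatr_eq0.
  rewrite map_inj_uniq ?iota_uniq // => m n /eqP.
  by rewrite eqr_nat => /eqP[].
by have := qE 0; rewrite q0 horner0 scale0r addr0.
Qed.

(** A minor is a polynomial in the entries, zero as soon as the rank drops. *)
Lemma zariski_closure_minor (K : fieldType) N m (S : set 'M[K]_N)
    (u v : 'I_m -> 'I_N) (M : 'M[K]_N) :
  (forall A, S A -> (\rank (mxsub u v A) < m)%N) ->
  zariski_closure S M -> \det (mxsub u v M) = 0.
Proof.
move=> rkS clM.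
pose minor : mpoly (N * N) K :=
  \det (\matrix_(s, t) mpolyX K (mnm1 (mxvec_index (u s) (v t)))).
have minorE A : meval (fun k => mxvec A 0 k) minor = \det (mxsub u v A).
  rewrite -det_map_mx; congr (\det _); apply/matrixP => s t.
  by rewrite !mxE /= mevalXU mxvecE.
rewrite -minorE; apply: clM => A /rkS rkA; rewrite minorE; apply/eqP.
apply: contraLR rkA => nz_det; rewrite -leqNgt mxrank_unit //.
by rewrite unitmxE unitfE.
Qed.

(** * Orbit closures of involutions *)

Lemma orbit_closure_B_stable (K : fieldType) N (p : 'S_N) (M : 'M[K]_N) :
  orbit_closure K p M -> B_orbit M `<=` orbit_closure K p.
Proof.
move=> clM _ [g bg <-]; pose L := mulmxr (invmx g) \o mulmx g.
by apply: (zariski_closure_linear (L := L)) clM => A; apply: B_orbit_conj.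
Qed.

Lemma pi_lt_in_orbit_closure (K : fieldType) N (p : 'S_N) :
  orbit_closure K p (pi_lt K p).
Proof.
move=> f; apply; apply: (@mem_B_orbit _ _ _ _ 1%:M).
  by split; [exact: unitmx1 | move=> i j lt_ji; rewrite mxE -val_eqE gtn_eqF].
by rewrite mul1mx mulmx1.
Qed.

Definition arches_within N (p : 'S_N) (a b : 'I_N) : {set 'I_N} :=
  [set i : 'I_N | [&& (a <= i)%N, (i < p i)%N & (p i <= b)%N]]%SET.

(** In a block with rows [>= a] and columns [<= b], an upper triangular
    [g *m M *m g^-1] only sees the same block of [M]; for [M] a partial
    permutation matrix it factors through its nonzero entries. *)
Lemma rank_conj_pi_lt (K : fieldType) N m (r : 'S_N) (a b : 'I_N)
    (u v : 'I_m -> 'I_N) (A : 'M[K]_N) :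
  (forall s, (a <= u s)%N) -> (forall t, (v t <= b)%N) ->
  B_orbit (pi_lt K r) A ->
  (\rank (mxsub u v A) <= #|arches_within r a b|)%N.
Proof.
move=> le_au le_vb [g bg <-]; set X := arches_within r a b.
pose U := \matrix_(s < m, k < #|X|) g (u s) (enum_val k).
pose V := \matrix_(k < #|X|, t < m) invmx g (r (enum_val k)) (v t).
suff -> : mxsub u v (g *m pi_lt K r *m invmx g) = U *m V.
  exact: mulmx_max_rank.
have ug := bg.2; have uG := upper_triangular_inv bg.
apply/matrixP => s t; rewrite mxE [RHS]mxE -mulmxA mxE.
under [RHS]eq_bigr do rewrite !mxE.
rewrite -(big_enum_val (fun i => g (u s) i * invmx g (r i) (v t))).
rewrite [RHS]big_mkcond; apply: eq_bigr => i _.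
have -> : (pi_lt K r *m invmx g) i (v t) =
    (i < r i)%:R * invmx g (r i) (v t).
  rewrite mxE (bigD1 (r i)) //= big1 => [|j ne_j].
    by rewrite mxE eqxx andbT addr0.
  by rewrite mxE eq_sym (negPf ne_j) andbF mul0r.
rewrite inE; case: ltnP => lt_i; last by rewrite andbF mul0r mulr0.
rewrite mul1r /=; have [le_ai|lt_ia] := leqP a i.
  have [//|lt_br] := leqP (r i) b.
  by rewrite uG ?mulr0 // (leq_ltn_trans (le_vb t)).
by rewrite ug ?mul0r // (leq_trans lt_ia).
Qed.

(** The minor of [pi_lt p] on the rows and columns of its arches inside
    [[a, b]] is [1]; on the orbit of [r] the rank of this block is at most the
    smaller number of arches of [r], so the same minor vanishes there. *)
Lemma pi_lt_notin_orbit_closure (K : fieldType) N (p r : 'S_N) (a b : 'I_N) :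
  (#|arches_within r a b| < #|arches_within p a b|)%N ->
  ~ orbit_closure K r (pi_lt K p).
Proof.
set X := arches_within p a b => lt_rp cl_rp.
have XP (s : 'I_#|X|) : [&& (a <= enum_val s)%N, (enum_val s < p (enum_val s))%N
    & (p (enum_val s) <= b)%N].
  by have := enum_valP s; rewrite inE.
have minor0 : \det (mxsub (fun s : 'I_#|X| => enum_val s)
    (fun t : 'I_#|X| => p (enum_val t)) (pi_lt K p)) = 0.
  apply: zariski_closure_minor cl_rp => A orbA.
  apply: leq_ltn_trans lt_rp; apply: rank_conj_pi_lt orbA => s.
    by case/and3P: (XP s).
  by case/and3P: (XP s).
have minor1 : mxsub (fun s : 'I_#|X| => enum_val s)
    (fun t : 'I_#|X| => p (enum_val t)) (pi_lt K p) = 1%:M.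
  apply/matrixP => s t; rewrite !mxE (inj_eq perm_inj) (inj_eq enum_val_inj).
  have [->|] := eqVneq s t; last by rewrite andbF.
  by case/and3P: (XP t) => _ ->.
by have := oner_neq0 K; rewrite -minor0 minor1 det1 eqxx.
Qed.

(** The arches of [r] inside the span of the arch [x] of [p] do not start in
    [s], so they are arches of [p] other than [x]: [r] has fewer arches there,
    and the two orbit closures differ. *)
Lemma orbit_gt_witness (K : fieldType) N (p r : 'S_N) (s : seq 'I_N)
    (x : 'I_N) :
  orbit_closure K p (pi_lt K r) -> agree_off p r s -> x \in s ->
  arch_at p x ->
  {in s, forall i : 'I_N, (x <= i)%N -> (i < r i)%N -> (p x < r i)%N} ->
  orbit_gt K p r.
Proof.
move=> cl_pr pr x_s arch_x r_s; split.
  exact/zariski_closure_min/orbit_closure_B_stable.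
move/(_ _ (pi_lt_in_orbit_closure (K := K) (p := p))).
apply: (pi_lt_notin_orbit_closure (a := x) (b := p x)).
have notin_s i : i \in arches_within r x (p x) -> i \notin s.
  rewrite inE => /and3P[le_xi lt_i le_i]; apply: contraL le_i => i_s.
  by rewrite -ltnNge r_s.
apply: proper_card; apply/properP; split.
  by apply/fintype.subsetP => i r_i; move: (r_i); rewrite !inE pr ?notin_s.
exists x; first by rewrite inE leqnn -/(arch_at p x) arch_x leqnn.
by apply/negP => /notin_s; rewrite x_s.
Qed.

(** * Degenerations supported on few boundary points *)

Definition local_pi_lt (K : fieldType) N (p : 'S_N) (s : seq 'I_N) :
    'M[K]_N :=
  \sum_(x <- s | (x < p x)%N) delta_mx x (p x).
Arguments local_pi_lt K {N} p s.

Lemma local_pi_ltE (K : fieldType) N (p : 'S_N) (s : seq 'I_N) x y :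
  uniq s -> local_pi_lt K p s x y = ((x \in s) && (x < y) && (p x == y))%N%:R.
Proof.
move=> uniq_s; rewrite /local_pi_lt summxE big_mkcond.
have -> : \sum_(i <- s) (if (i < p i)%N then delta_mx i (p i) x y else 0 : K) =
    \sum_(i <- s | i == x) ((x < y)%N && (p x == y))%:R.
  rewrite [RHS]big_mkcond; apply: eq_bigr => i _; rewrite mxE.
  have [->|ne_ix] := eqVneq i x; last by rewrite if_same.
  rewrite /= [y == _]eq_sym; have [->|_] := eqVneq (p x) y.
    by rewrite andbT; case: ltnP.
  by rewrite andbF; case: ifP.
have [x_s|x_s] := boolP (x \in s).
  by rewrite -big_filter filter_pred1_uniq // big_seq1.
rewrite big_seq_cond big_pred0 // => i.
by have [->|_] := eqVneq i x; rewrite ?andbF // (negPf x_s).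
Qed.

Definition block_upper (K : fieldType) N (s : seq 'I_N) (E : 'M[K]_N) :=
  forall x y : 'I_N, ~~ [&& x \in s, y \in s & (x <= y)%N] -> E x y = 0.

Lemma block_upperD (K : fieldType) N (s : seq 'I_N) (E F : 'M[K]_N) :
  block_upper s E -> block_upper s F -> block_upper s (E + F).
Proof. by move=> sE sF x y xy; rewrite mxE sE // sF // addr0. Qed.

Lemma block_upperZ (K : fieldType) N (s : seq 'I_N) c (E : 'M[K]_N) :
  block_upper s E -> block_upper s (c *: E).
Proof. by move=> sE x y xy; rewrite mxE sE // mulr0. Qed.

Lemma block_upper_delta (K : fieldType) N (s : seq 'I_N) a b :
  a \in s -> b \in s -> (a <= b)%N -> block_upper s (delta_mx a b : 'M[K]_N).
Proof.
move=> a_s b_s le_ab x y; rewrite mxE.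
by case: eqVneq => [->|//]; case: eqVneq => [->|//]; rewrite a_s b_s le_ab.
Qed.

(** The curves that [p] and [r] share live on boundary points outside [s], so
    their part of the matrix is annihilated on both sides by [E] and unchanged
    by conjugation with [1 + E]: the degeneration happens in the block [s]. *)
Lemma local_degeneration (K : numFieldType) N (p r : 'S_N) (s : seq 'I_N)
    (C : 'M[K]_N) :
  is_involution p -> uniq s -> {in s, forall x, p x \in s} ->
  agree_off p r s ->
  (forall e : K, e != 0 -> exists E : 'M[K]_N,
    [/\ block_upper s E, forall x, 1 + E x x != 0 &
        (1%:M + E) *m local_pi_lt K p s =
        (local_pi_lt K r s + e *: C) *m (1%:M + E)]) ->
  orbit_closure K p (pi_lt K r).
Proof.
move=> inv_p uniq_s s_stable pr localE.
pose M0 := pi_lt K p - local_pi_lt K p s.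
have M0E x y : M0 x y = ((x \notin s) && (x < y) && (p x == y))%N%:R.
  rewrite /M0 mxE [X in _ + X]mxE local_pi_ltE // mxE.
  by case: (x \in s); rewrite /= ?subrr ?subr0.
have pM0 : pi_lt K p = M0 + local_pi_lt K p s by rewrite subrK.
clearbody M0.
have rM0 : pi_lt K r = M0 + local_pi_lt K r s.
  apply/matrixP => x y; rewrite [RHS]mxE M0E local_pi_ltE // mxE.
  by have [x_s|x_s] := boolP (x \in s); rewrite ?add0r ?addr0 //= pr.
have M0_row x y : x \in s -> M0 x y = 0 by move=> x_s; rewrite M0E x_s.
have M0_col x y : y \in s -> M0 x y = 0.
  move=> y_s; rewrite M0E; have [pxy|_] := eqVneq (p x) y; last by rewrite andbF.
  by rewrite -(inv_p x) pxy s_stable.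
apply: (zariski_closure_line (C := C)) => e /localE[E [uE nzE eqE]].
apply: (@mem_B_orbit _ _ _ _ (1%:M + E)).
  have u1E : upper_triangular (1%:M + E).
    move=> i j lt_ji; rewrite !mxE -val_eqE gtn_eqF // uE ?addr0 //.
    by rewrite leqNgt lt_ji /= !andbF.
  split=> //; rewrite unitmx_upper_triangular //; apply/forallP => x.
  by rewrite !mxE eqxx.
have EM0 : E *m M0 = 0.
  apply/matrixP => x y; rewrite !mxE big1 // => k _.
  have [k_s|k_s] := boolP (k \in s); first by rewrite M0_row ?mulr0.
  by rewrite uE ?mul0r // (negPf k_s) andbF.
have M0E0 : M0 *m E = 0.
  apply/matrixP => x y; rewrite !mxE big1 // => k _.
  have [k_s|k_s] := boolP (k \in s); first by rewrite M0_col ?mul0r.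
  by rewrite uE ?mulr0 // (negPf k_s).
rewrite pM0 rM0 -addrA [LHS]mulmxDr eqE [RHS]mulmxDl; congr (_ + _).
by rewrite mulmxDl mulmxDr EM0 M0E0 mul1mx mulmx1.
Qed.

Lemma local_pi_lt_cons (K : fieldType) N (p : 'S_N) x (s : seq 'I_N) :
  local_pi_lt K p (x :: s) =
  (if (x < p x)%N then delta_mx x (p x) else 0) + local_pi_lt K p s.
Proof. by rewrite /local_pi_lt big_cons; case: ifP; rewrite ?add0r. Qed.

Lemma local_pi_lt_nil (K : fieldType) N (p : 'S_N) :
  local_pi_lt K p [::] = 0.
Proof. exact: big_nil. Qed.

(** * The three moves *)

Lemma ltn_ord_neq N (x y : 'I_N) :
  (x < y)%N -> ((x == y) = false) * ((y == x) = false).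
Proof. by move=> lt_xy; rewrite -!val_eqE ltn_eqF // gtn_eqF. Qed.

(** Scaling row [j] by [e] gives [e * e_jk], which tends to [0]. *)
Lemma remove_arch_degeneration (K : numFieldType) N (p r : 'S_N) (j k : 'I_N) :
  is_involution p -> (j < k)%N -> p j = k -> r j = j -> r k = k ->
  agree_off p r [:: j; k] -> orbit_closure K p (pi_lt K r).
Proof.
move=> inv_p lt_jk pj rj rk pr; have pk : p k = j by rewrite -pj inv_p.
have neE := ltn_ord_neq lt_jk.
apply: (local_degeneration (s := [:: j; k]) (C := delta_mx j k)) => //.
- by rewrite /= inE neE.
- by move=> x; rewrite !inE => /orP[]/eqP->; rewrite ?pj ?pk eqxx ?orbT.
move=> e nz_e; exists ((e - 1) *: delta_mx j j); split.
- by apply: block_upperZ; apply: block_upper_delta; rewrite ?inE ?eqxx.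
- move=> x; rewrite !mxE andbb; case: (eqVneq x j) => _ /=.
    by rewrite mulr1 addrC subrK.
  by rewrite mulr0 addr0 oner_neq0.
rewrite !local_pi_lt_cons !local_pi_lt_nil pj pk rj rk lt_jk !ltnn.
rewrite ltnNge (ltnW lt_jk) /= !addr0 !add0r.
rewrite !(mulmxDl, mulmxDr) -?scalemxAl -?scalemxAr !mul1mx !mulmx1.
rewrite -?scalemxAl !mul_delta_mx_cond ?eqxx ?neE !mulr0n !mulr1n.
by apply/matrixP => x y; rewrite !mxE; ring.
Qed.

(** Adding row [j] to row [i], and then scaling row [j] by [e], turns [e_jk]
    into [e_ik + e * e_jk]; the compensating column operations subtract column
    [i] from column [j] and rescale column [j], and both columns are [0]. *)
Lemma extend_arch_left_degeneration (K : numFieldType) N (p r : 'S_N)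
    (i j k : 'I_N) :
  is_involution p -> (i < j)%N -> (j < k)%N -> p i = i -> p j = k ->
  r i = k -> r k = i -> r j = j ->
  agree_off p r [:: i; j; k] -> orbit_closure K p (pi_lt K r).
Proof.
move=> inv_p lt_ij lt_jk pi pj ri rk rj pr.
have pk : p k = j by rewrite -pj inv_p.
have lt_ik := ltn_trans lt_ij lt_jk.
have neE := (ltn_ord_neq lt_ij, ltn_ord_neq lt_jk, ltn_ord_neq lt_ik).
apply: (local_degeneration (s := [:: i; j; k]) (C := delta_mx j k)) => //.
- by rewrite /= !inE !neE.
- by move=> x; rewrite !inE => /or3P[]/eqP->; rewrite ?pi ?pj ?pk eqxx ?orbT.
move=> e nz_e; exists (delta_mx i j + (e - 1) *: delta_mx j j); split.
- by apply: block_upperD; [|apply: block_upperZ]; apply: block_upper_delta;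
    rewrite ?inE ?eqxx ?orbT // ltnW.
- move=> x; rewrite !mxE.
  have [->|_] := eqVneq x j; first by rewrite neE /= mulr1 add0r addrC subrK.
  by rewrite andbF mulr0 !addr0 oner_neq0.
rewrite !local_pi_lt_cons !local_pi_lt_nil pi pj pk ri rj rk lt_jk lt_ik !ltnn.
rewrite !(ltnNge k) (ltnW lt_jk) (ltnW lt_ik) /= !addr0 !add0r.
rewrite !(mulmxDl, mulmxDr) -?scalemxAl -?scalemxAr !mul1mx !mulmx1.
rewrite -?scalemxAl !mul_delta_mx_cond ?eqxx ?neE !mulr0n !mulr1n.
by apply/matrixP => x y; rewrite !mxE; ring.
Qed.

(** Dually, a multiple of column [k] is added to column [i], and row [j] is
    scaled by [e]; the compensating operations act on the rows [i] and [k],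
    which are [0]. *)
Lemma extend_arch_right_degeneration (K : numFieldType) N (p r : 'S_N)
    (j k i : 'I_N) :
  is_involution p -> (j < k)%N -> (k < i)%N -> p i = i -> p j = k ->
  r j = i -> r i = j -> r k = k ->
  agree_off p r [:: i; j; k] -> orbit_closure K p (pi_lt K r).
Proof.
move=> inv_p lt_jk lt_ki pi pj rj ri rk pr.
have pk : p k = j by rewrite -pj inv_p.
have lt_ji := ltn_trans lt_jk lt_ki.
have neE := (ltn_ord_neq lt_jk, ltn_ord_neq lt_ki, ltn_ord_neq lt_ji).
apply: (local_degeneration (s := [:: i; j; k]) (C := delta_mx j k)) => //.
- by rewrite /= !inE !neE.
- by move=> x; rewrite !inE => /or3P[]/eqP->; rewrite ?pi ?pj ?pk eqxx ?orbT.
move=> e nz_e.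
(* Row [k] of the inverse of [1 + E] is [1] at [k] and [1 / e] at [i], so that
   [e * e_jk] becomes [e * e_jk + e_ji]. *)
exists ((-1) *: delta_mx k i +
  ((e - 1) *: delta_mx i i + (e - 1) *: delta_mx j j)); split.
- by do !apply: block_upperD; apply: block_upperZ; apply: block_upper_delta;
    rewrite ?inE ?eqxx ?orbT // ltnW.
- move=> x; rewrite !mxE.
  have [->|_] := eqVneq x i.
    by rewrite !neE /= !mulr0 mulr1 add0r addr0 addrC subrK.
  have [->|_] := eqVneq x j.
    by rewrite !neE /= !mulr0 mulr1 !add0r addrC subrK.
  by rewrite !andbF !mulr0 !addr0 oner_neq0.
rewrite !local_pi_lt_cons !local_pi_lt_nil pi pj pk ri rj rk lt_jk lt_ji !ltnn.
rewrite !(ltnNge i) !(ltnNge k) (ltnW lt_jk) (ltnW lt_ji) /= !addr0 !add0r.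
rewrite !(mulmxDl, mulmxDr) -?scalemxAl -?scalemxAr !mul1mx !mulmx1.
rewrite -?scalemxAl !mul_delta_mx_cond ?eqxx ?neE !mulr0n !mulr1n.
by apply/matrixP => x y; rewrite !mxE; ring.
Qed.

(** Only rows [a, b] and columns [c, e] matter: there [p_<] is antidiagonal
    and the line is [[1, 0], [t, 1]], a matrix with nonzero lower left entry
    and nonzero determinant, so that upper triangular row and column
    operations make it antidiagonal. *)
Lemma nested_arches_degeneration (K : numFieldType) N (p r : 'S_N)
    (a b c e : 'I_N) :
  is_involution p -> (a < b)%N -> (b < c)%N -> (c < e)%N ->
  p a = e -> p b = c -> r a = c -> r c = a -> r b = e -> r e = b ->
  agree_off p r [:: a; b; c; e] -> orbit_closure K p (pi_lt K r).
Proof.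
move=> inv_p lt_ab lt_bc lt_ce pa pb ra rc rb re pr.
have pe : p e = a by rewrite -pa inv_p.
have pc : p c = b by rewrite -pb inv_p.
have lt_ac := ltn_trans lt_ab lt_bc; have lt_be := ltn_trans lt_bc lt_ce.
have lt_ae := ltn_trans lt_ab lt_be.
have neE := (ltn_ord_neq lt_ab, ltn_ord_neq lt_ac, ltn_ord_neq lt_ae,
  ltn_ord_neq lt_bc, ltn_ord_neq lt_be, ltn_ord_neq lt_ce).
apply: (local_degeneration (s := [:: a; b; c; e]) (C := delta_mx b c)) => //.
- by rewrite /= !inE !neE.
- by move=> x; rewrite !inE => /or4P[]/eqP->;
    rewrite ?pa ?pb ?pc ?pe eqxx ?orbT.
move=> z nz_z.
(* Rows: [[1, 1], [0, z]] [[0, 1], [1, 0]] = [[1, 1], [z, 0]]; columns: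
   [[1, 0], [z, 1]] [[1, 1], [0, -z]] = [[1, 1], [z, 0]]. *)
exists ((delta_mx a b + delta_mx c e) +
  ((z - 1) *: delta_mx b b + (- z - 1) *: delta_mx e e)); split.
- by do !apply: block_upperD; try apply: block_upperZ;
    apply: block_upper_delta; rewrite ?inE ?eqxx ?orbT // ltnW.
- move=> x; rewrite !mxE.
  have [->|_] := eqVneq x b.
    by rewrite !neE /= !mulr0 mulr1 !add0r addr0 addrC subrK.
  have [->|_] := eqVneq x e.
    by rewrite !neE /= !mulr0 mulr1 !add0r addrC subrK oppr_eq0.
  by rewrite !andbF !mulr0 !addr0 oner_neq0.
rewrite !local_pi_lt_cons !local_pi_lt_nil pa pb pc pe ra rb rc re.
rewrite lt_ac lt_be lt_bc lt_ae !(ltnNge e) !(ltnNge c).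
rewrite (ltnW lt_ac) (ltnW lt_be) (ltnW lt_bc) (ltnW lt_ae) /= !addr0.
rewrite !(mulmxDl, mulmxDr) -?scalemxAl -?scalemxAr !mul1mx !mulmx1.
rewrite -?scalemxAl !mul_delta_mx_cond ?eqxx ?neE !mulr0n !mulr1n.
by apply/matrixP => x y; rewrite !mxE; ring.
Qed.

(** Conjugating [e_ab + e_ce] by [1 + e_bc] adds [e_be - e_ac]; a diagonal
    conjugation then corrects the sign of [e_ac] and makes the coefficients of
    the two old arches tend to [0]. *)
Lemma adjacent_arches_degeneration (K : numFieldType) N (p r : 'S_N)
    (a b c e : 'I_N) :
  is_involution p -> (a < b)%N -> (b < c)%N -> (c < e)%N ->
  p a = b -> p c = e -> r a = c -> r c = a -> r b = e -> r e = b ->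
  agree_off p r [:: a; b; c; e] -> orbit_closure K p (pi_lt K r).
Proof.
move=> inv_p lt_ab lt_bc lt_ce pa pc ra rc rb re pr.
have pb : p b = a by rewrite -pa inv_p.
have pe : p e = c by rewrite -pc inv_p.
have lt_ac := ltn_trans lt_ab lt_bc; have lt_be := ltn_trans lt_bc lt_ce.
have lt_ae := ltn_trans lt_ab lt_be.
have neE := (ltn_ord_neq lt_ab, ltn_ord_neq lt_ac, ltn_ord_neq lt_ae,
  ltn_ord_neq lt_bc, ltn_ord_neq lt_be, ltn_ord_neq lt_ce).
apply: (local_degeneration (s := [:: a; b; c; e])
  (C := delta_mx c e - delta_mx a b)) => //.
- by rewrite /= !inE !neE.
- by move=> x; rewrite !inE => /or4P[]/eqP->;
    rewrite ?pa ?pb ?pc ?pe eqxx ?orbT.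
move=> z nz_z.
(* [1 + e_bc] followed by the diagonal matrix with entries [-z, 1, z, 1] at
   [a, b, c, e]. *)
exists (delta_mx b c +
  ((- z - 1) *: delta_mx a a + (z - 1) *: delta_mx c c)); split.
- by do !apply: block_upperD; try apply: block_upperZ;
    apply: block_upper_delta; rewrite ?inE ?eqxx ?orbT // ltnW.
- move=> x; rewrite !mxE.
  have [->|_] := eqVneq x a.
    by rewrite !neE /= !mulr0 mulr1 !add0r addr0 addrC subrK oppr_eq0.
  have [->|_] := eqVneq x c.
    by rewrite !neE /= !mulr0 mulr1 !add0r addrC subrK.
  by rewrite !andbF !mulr0 !addr0 oner_neq0.
rewrite !local_pi_lt_cons !local_pi_lt_nil pa pb pc pe ra rb rc re.
rewrite lt_ac lt_be lt_ab lt_ce !(ltnNge e) !(ltnNge c) (ltnNge b a).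
rewrite (ltnW lt_ac) (ltnW lt_be) (ltnW lt_ab) (ltnW lt_ce) /= !addr0 !add0r.
rewrite scalerBr !(mulmxDl, mulmxDr, mulNmx) -?scalemxAl -?scalemxAr.
rewrite !mul1mx !mulmx1.
rewrite -?scalemxAl !mul_delta_mx_cond ?eqxx ?neE !mulr0n !mulr1n.
by apply/matrixP => x y; rewrite !mxE; ring.
Qed.

(** With [i < j], not crossing leaves only the orders [i < j < p j < p i] and
    [i < p i < j < p j], and an increasing list is determined by its
    elements. *)
Lemma noncrossing_arches_cases N (p : 'S_N) (i j a b c e : 'I_N) :
  arch_at p i -> arch_at p j -> ~~ arches_cross p i j ->
  (a < b)%N -> (b < c)%N -> (c < e)%N ->
  perm_eq [:: a; b; c; e] [:: i; p i; j; p j] ->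
  (p a = e /\ p b = c) \/ (p a = b /\ p c = e).
Proof.
rewrite /arch_at => arch_i arch_j nocross lt_ab lt_bc lt_ce eq_s.
have uniq_s : uniq [:: i; p i; j; p j].
  by rewrite -(perm_uniq eq_s) /= !inE -!val_eqE /=; lia.
wlog lt_ij : i j arch_i arch_j nocross eq_s uniq_s / (i < j)%N.
  move=> base; have [lt_ij|lt_ji|/val_inj eq_ij] := ltngtP i j.
  - exact: (base i j).
  - have eq_rot : perm_eq [:: j; p j; i; p i] [:: i; p i; j; p j].
      exact/permPl/(perm_catC [:: j; p j] [:: i; p i]).
    apply: (base j i) => //; first by rewrite /arches_cross orbC.
      by rewrite (perm_trans eq_s) // perm_sym.
    by rewrite (perm_uniq eq_rot).
  - by move: uniq_s; rewrite eq_ij /= !inE eqxx orbT.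
have sorted_s s : perm_eq [:: a; b; c; e] s ->
    sorted (fun x y : 'I_N => (x < y)%N) s -> s = [:: a; b; c; e].
  move=> eq_s' sorted_s'; apply: (irr_sorted_eq (leT := fun x y : 'I_N => (x < y)%N)).
  - by move=> y x z; apply: ltn_trans.
  - by move=> x; apply: ltnn.
  - exact: sorted_s'.
  - by rewrite /= lt_ab lt_bc lt_ce.
  - by move=> x; rewrite (perm_mem eq_s').
move: uniq_s; rewrite /= !inE -!val_eqE /= => uniq_s.
have [lt_pij|le_jpi] := ltnP (p i) j.
  have eq_abce : [:: i; p i; j; p j] = [:: a; b; c; e].
    by apply: sorted_s => //; rewrite /= arch_i lt_pij arch_j.
  by case: eq_abce => <- <- <- <-; right.
have lt_pji : (p j < p i)%N by move: nocross; rewrite /arches_cross; lia.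
have eq_nest : perm_eq [:: i; p i; j; p j] [:: i; j; p j; p i].
  by rewrite perm_cons; apply/permPl/(perm_catC [:: p i] [:: j; p j]).
have eq_abce : [:: i; j; p j; p i] = [:: a; b; c; e].
  apply: sorted_s; first exact: perm_trans eq_s eq_nest.
  by rewrite /= lt_ij arch_j lt_pji.
by case: eq_abce => <- <- <- <-; left.
Qed.

Theorem proposition1 (R : realType) (N : nat) (hN : (0 < N)%N)
    (p : 'S_N) (hp : is_involution p) (d : drawing R p) (r : 'S_N)
    (hr : move1 d r \/ move2 d r \/ move3 d r) :
  orbit_gt (complex R) p r /\
  (B_orbit (pi_lt (complex R) r) `<=` orbit_closure (complex R) p)%classic.
Proof.
suff [cl_pr gt_pr] : orbit_closure (complex R) p (pi_lt (complex R) r) /\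
    orbit_gt (complex R) p r.
  by split=> //; exact: orbit_closure_B_stable.
case: hr => [|[]].
- move=> [i [j [[arch_i arch_j] _ nocross _ [a [b [c [e]]]]]]].
  move=> [/and3P[lt_ab lt_bc lt_ce] eq_s [ra rc] [rb re] pr].
  have [[pa pb]|[pa pc]] :=
      noncrossing_arches_cases arch_i arch_j nocross lt_ab lt_bc lt_ce eq_s.
    have cl_pr : orbit_closure (complex R) p (pi_lt (complex R) r).
      exact: (nested_arches_degeneration (a := a) (b := b) (c := c) (e := e)).
    split=> //; apply: (orbit_gt_witness (x := b) cl_pr pr).
    + by rewrite !inE eqxx orbT.
    + by rewrite /arch_at pb.
    by move=> x; rewrite !inE pb => /or4P[]/eqP->; rewrite ?ra ?rb ?rc ?re; lia.
  have cl_pr : orbit_closure (complex R) p (pi_lt (complex R) r).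
    exact: (adjacent_arches_degeneration (a := a) (b := b) (c := c) (e := e)).
  split=> //; apply: (orbit_gt_witness (x := a) cl_pr pr).
  + by rewrite inE eqxx.
  + by rewrite /arch_at pa.
  by move=> x; rewrite !inE pa => /or4P[]/eqP->; rewrite ?ra ?rb ?rc ?re; lia.
- move=> [i [j [[/eqP pi arch_j] _ _ pr ends]]].
  set k := p j in pr ends; have lt_jk : (j < k)%N by [].
  have cl_pr : orbit_closure (complex R) p (pi_lt (complex R) r).
    case: ends => [[lt_ij [ri rk rj]]|[lt_ki [rj ri rk]]].
      exact: (extend_arch_left_degeneration (i := i) (j := j) (k := k)).
    exact: (extend_arch_right_degeneration (i := i) (j := j) (k := k)).
  split=> //; apply: (orbit_gt_witness (x := j) cl_pr pr) => //.
    by rewrite !inE eqxx orbT.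
  move=> x; rewrite -/k.
  case: ends => [[lt_ij [ri rk rj]]|[lt_ki [rj ri rk]]]; rewrite !inE;
    by case/or3P => /eqP->; rewrite ?ri ?rj ?rk; lia.
- move=> [j [arch_j _ _ [rj rk] pr]]; set k := p j in rk pr.
  have cl_pr : orbit_closure (complex R) p (pi_lt (complex R) r).
    exact: (remove_arch_degeneration (j := j) (k := k)).
  split=> //; apply: (orbit_gt_witness (x := j) cl_pr pr) => //.
    by rewrite inE eqxx.
  by move=> x; rewrite !inE => /orP[]/eqP->; rewrite ?rj ?rk ltnn.
Qed.
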